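(* Let $q$ be a prime power. In $PG(3,q)$ with homogeneous coordinates $(x_0,x_1,x_2,x_3)$, let $l_1:\ x_0=x_2=0$, $l_2:\ x_1=x_3=0$, $l_3:\ x_0=x_3,\ x_1=x_2$, let $\mathcal{Q}$ be the hyperbolic quadric $x_0x_1=x_2x_3$, and let $g$ be any line of $PG(3,q)$ disjoint from $\mathcal{Q}$. Then $B=l_1\cup l_2\cup l_3\cup g$ has size $4q+4$ and is a $3$-fold strong blocking set in $PG(3,q)$.
   Context: For $2\leq t\leq v$, a point set $B$ in $PG(v,q)$ is a $t$-fold strong blocking set if every $(t-1)$-dimensional subspace of $PG(v,q)$ is spanned by $t$ points of $B$. Thus a $3$-fold strong blocking set in $PG(3,q)$ is a set such that every plane contains three non-collinear points of the set. *)

(* Defs.v *)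
From HB Require Import structures.
From mathcomp Require Import all_boot all_order all_algebra.

Set Implicit Arguments.
Unset Strict Implicit.
Unset Printing Implicit Defensive.

Import GRing.Theory VectorInternalTheory.
Local Open Scope ring_scope.

(* MathComp only makes {vspace V} a choiceType; over a finite field it is also *)
(* a finType, being a subtype of square matrices.                              *)
HB.instance Definition _ (F : finFieldType) (V : vectType F) :=
  [Countable of {vspace V} by <:].
HB.instance Definition _ (F : finFieldType) (V : vectType F) :=
  [Finite of {vspace V} by <:].

(* PG(v,q) is the lattice of subspaces of F^(v+1), #|F| = q: a projective      *)
(* d-dimensional subspace is a {vspace 'rV[F]_v.+1} of vector dimension d + 1. *)
Definition pg_point (F : finFieldType) (v : nat) :=
  {P : {vspace 'rV[F]_v.+1} | \dim P == 1%N}.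

HB.instance Definition _ (F : finFieldType) (v : nat) :=
  Finite.on (pg_point F v).

Definition points_of (F : finFieldType) (v : nat)
    (U : {vspace 'rV[F]_v.+1}) : {set pg_point F v} :=
  [set P : pg_point F v | (val P <= U)%VS].

(* The condition e is meant to be homogeneous: it is then equivalent to test   *)
(* all coordinate vectors of P or a single nonzero one.                        *)
Definition locus (F : finFieldType) (v : nat)
    (e : pred 'rV[F]_v.+1) : {set pg_point F v} :=
  [set P : pg_point F v | [forall x : 'rV[F]_v.+1, (x \in val P) ==> e x]].

(* Used for 2 <= t <= v. The subspaces U below are those of projective         *)
(* dimension t - 1.                                                            *)
Definition strong_blocking_set (F : finFieldType) (v t : nat)
    (B : {set pg_point F v}) : Prop :=
  forall U : {vspace 'rV[F]_v.+1}, \dim U = t ->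
  exists S : {set pg_point F v},
    [/\ S \subset B, #|S| = t & (\sum_(P in S) val P)%VS = U].

Definition line1 (F : finFieldType) : {set pg_point F 3} :=
  locus (fun x : 'rV[F]_4 => (x 0 0 == 0) && (x 0 2 == 0)).
Definition line2 (F : finFieldType) : {set pg_point F 3} :=
  locus (fun x : 'rV[F]_4 => (x 0 1 == 0) && (x 0 3 == 0)).
Definition line3 (F : finFieldType) : {set pg_point F 3} :=
  locus (fun x : 'rV[F]_4 => (x 0 0 == x 0 3) && (x 0 1 == x 0 2)).
Definition hyperbolic_quadric (F : finFieldType) : {set pg_point F 3} :=
  locus (fun x : 'rV[F]_4 => x 0 0 * x 0 1 == x 0 2 * x 0 3).

(* Main.v *)
(* The lines l_1, l_2, l_3 are pairwise disjoint and lie on Q, and every line  *)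
(* meeting all three lies on Q (it belongs to the opposite regulus).  A plane  *)
(* U meets l_1, l_2, l_3 and g in points P_1, P_2, P_3 and P_4.  If the first  *)
(* three are collinear, their line is contained in Q and hence misses P_4, so  *)
(* P_1, P_2, P_4 span U.                                                       *)

Require Import Defs.
From HB Require Import structures.
From mathcomp Require Import all_boot all_order all_algebra.
From mathcomp Require Import finfield ring zify.

Set Implicit Arguments.
Unset Strict Implicit.
Unset Printing Implicit Defensive.

Import GRing.Theory.
Local Open Scope ring_scope.

(** The four lines are pairwise skew: the first three by their equations, and [g] because it misses
    a quadric containing them. Each has q + 1 points ([card_points_of]), which gives the size. For
    blocking, a plane meets every line, so it yields nonzero vectors x, y, z, w on the four lines,
    with x and y independent. If z lies outside the span of x and y, then x, y, z span the plane.
    Otherwise that span is a line of the opposite regulus, contained in the quadric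
    ([regulus_quadric]), so w lies outside it and x, y, w span the plane ([span_point3]). *)

Lemma memv_line2P (K : fieldType) (vT : vectType K) (u w x : vT) :
  reflect (exists a b : K, x = a *: u + b *: w) (x \in (<[u]> + <[w]>)%VS).
Proof.
apply: (iffP memv_addP) => [[_ /vlineP[a ->]] [_ /vlineP[b ->] ->]|[a [b ->]]].
  by exists a, b.
by exists (a *: u); [|exists (b *: w)]; rewrite ?memvZ ?memv_line.
Qed.

Lemma dimv_add_line (K : fieldType) (vT : vectType K) (U : {vspace vT}) (v : vT) :
  v \notin U -> \dim (U + <[v]>) = (\dim U).+1.
Proof.
move=> vNU; have v0 : v != 0 by apply: contraNneq vNU => ->; rewrite mem0v.
rewrite dimv_disjoint_sum ?dim_vline ?v0 ?addn1 //.
apply/eqP; rewrite -subv0; apply/subvP => x; rewrite memv_cap => /andP[xU].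
case/vlineP=> k def_x; rewrite memv0; apply: contraNT vNU => x0.
have k0 : k != 0 by apply: contraNneq x0 => k0; rewrite def_x k0 scale0r.
by rewrite -[v](scalerK k0) -def_x memvZ.
Qed.

Lemma dimv_line2 (K : fieldType) (vT : vectType K) (u w : vT) :
  u != 0 -> w \notin <[u]>%VS -> \dim (<[u]> + <[w]>) = 2%N.
Proof. by move=> u0 uw; rewrite dimv_add_line // dim_vline u0. Qed.

(** By Grassmann's formula the intersection has positive dimension, so [vpick] returns a nonzero
    vector of it. *)
Lemma exists_capv (K : fieldType) (vT : vectType K) (U V : {vspace vT}) :
  (dim vT < \dim U + \dim V)%N -> exists x, [/\ x \in U, x \in V & x != 0].
Proof.
move=> dimUV; exists (vpick (U :&: V)).
have := memv_pick (U :&: V); rewrite memv_cap => /andP[-> ->]; split=> //.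
rewrite vpick0 -dimv_eq0; have := dimvS (subvf (U + V)); rewrite dimvf.
by have := dimv_sum_cap U V; lia.
Qed.

(** * Projective points: counting and spanning *)

Section Points.

Variables (F : finFieldType) (n : nat).
Implicit Types (U V : {vspace 'rV[F]_n.+1}) (x y z : 'rV[F]_n.+1).

Lemma dim_vline_eq1 x : x != 0 -> \dim <[x]> == 1%N.
Proof. by rewrite dim_vline => ->. Qed.

Definition point x (x0 : x != 0) : pg_point F n :=
  exist _ <[x]>%VS (dim_vline_eq1 x0).

Lemma point_in x (x0 : x != 0) U : (point x0 \in points_of U) = (x \in U).
Proof. by rewrite inE /= memvE. Qed.

Lemma mem_point x (x0 : x != 0) (P : pg_point F n) :
  (x \in val P) = (P == point x0).
Proof.
rewrite -val_eqE /= [RHS]eq_sym memvE eqEdim.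
by rewrite (eqP (valP P)) dim_vline x0 andbT.
Qed.

(** Double counting of the pairs of a point of [U] and a nonzero vector on it. Each point carries q
    - 1 such vectors, and each nonzero vector of [U] lies on exactly one point. The product form
    avoids a division. *)
Lemma card_points_of U :
  (#|points_of U| * #|F|.-1 = (#|F| ^ \dim U).-1)%N.
Proof.
have card_nz V : #|[pred x in V | x != 0]| = (#|F| ^ \dim V).-1.
  rewrite -card_vspace (cardD1 0 (mem V)) mem0v /=.
  by apply: eq_card => x; rewrite !inE andbC.
rewrite -card_nz -sum_nat_const.
transitivity (\sum_(P in points_of U) \sum_(x in [pred x in val P | x != 0%R]) 1)%N.
  by apply: eq_bigr => P _; rewrite sum1_card card_nz (eqP (valP P)) expn1.
rewrite (exchange_big_dep (mem [pred x in U | x != 0])) /=; last first.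
  move=> P x; rewrite !inE => /subvP PU /andP[/PU-> ->] //.
rewrite -sum1_card; apply: eq_bigr => x /andP[xU x0].
rewrite (big_pred1 (point x0)) // => P; rewrite /= !inE x0 andbT mem_point.
by case: eqP => [->|]; rewrite ?andbF // andbT -memvE.
Qed.

Lemma locus_points_of (e : pred 'rV[F]_n.+1) U :
  (forall x, e x = (x \in U)) -> locus e = points_of U.
Proof.
move=> eU; apply/setP => P; rewrite !inE.
by apply/'forall_implyP/subvP => PU x /PU; rewrite eU.
Qed.

Lemma disjoint_points_of U V :
  (U :&: V = 0)%VS -> [disjoint points_of U & points_of V].
Proof.
move=> UV0; apply/pred0P => P /=; rewrite !inE -subv_cap UV0 subv0.
by rewrite -dimv_eq0 (eqP (valP P)).
Qed.

(** The cardinality of the spanning set comes for free: if two of the points coincided, [U] would be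
    spanned by two points and have dimension at most 2. *)
Lemma span_points3 U (B : {set pg_point F n}) (P Q R : pg_point F n) :
    \dim U = 3%N -> (val P + val Q + val R)%VS = U ->
    [/\ P \in B, Q \in B & R \in B] ->
  exists S : {set pg_point F n},
    [/\ S \subset B, #|S| = 3 & (\sum_(P in S) val P)%VS = U].
Proof.
move=> dimU defU [PB QB RB].
have dim2 (P1 P2 : pg_point F n) : (val P1 + val P2)%VS <> U.
  move=> E; have := (dimv_add_leqif (val P1) (val P2)).1.
  by rewrite E (eqP (valP P1)) (eqP (valP P2)) dimU.
(* In Prop: converting boolean equalities of distinct points diverges in practice. *)
have neq_PQ : P <> Q.
  by move=> E; apply: (dim2 P R); rewrite -defU -E addvv.
have neq_PR : P <> R.
  by move=> E; apply: (dim2 P Q); rewrite -defU -E [in RHS]addvC addvA addvv.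
have neq_QR : Q <> R.
  by move=> E; apply: (dim2 P Q); rewrite -defU -E -addvA addvv.
have PNQR : P \notin [set Q; R].
  by apply/set2P => -[E|E]; [exact: neq_PQ E|exact: neq_PR E].
have QNR : Q \notin [set R] by apply/set1P.
exists (P |: [set Q; R]); split.
- by apply/subsetP => P1 /setU1P[->|/set2P[]->].
- by rewrite cardsU1 PNQR cardsU1 QNR cards1.
by rewrite (big_setU1 _ PNQR) (big_setU1 _ QNR) big_set1 /= addvA.
Qed.

Lemma span_point3 U (B : {set pg_point F n}) x y z
    (x0 : x != 0) (y0 : y != 0) (z0 : z != 0) :
    \dim U = 3%N -> [/\ x \in U, y \in U & z \in U] ->
    y \notin <[x]>%VS -> z \notin (<[x]> + <[y]>)%VS ->
    [/\ point x0 \in B, point y0 \in B & point z0 \in B] ->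
  exists S : {set pg_point F n},
    [/\ S \subset B, #|S| = 3 & (\sum_(P in S) val P)%VS = U].
Proof.
move=> dimU [xU yU zU] xy xyz; apply: span_points3 => //=.
apply/eqP; rewrite eqEdim !subv_add -!memvE xU yU zU /=.
by rewrite !dimv_add_line // dim_vline x0 dimU.
Qed.

End Points.

(** * The three lines on the quadric and their transversals *)

Section FourLines.

Variable F : finFieldType.
Implicit Types (a b c d : F) (x y z : 'rV[F]_4).

Definition row4 a b c d : 'rV[F]_4 := \row_j [:: a; b; c; d]`_j.

Lemma row4P x y :
  x 0 0 = y 0 0 -> x 0 1 = y 0 1 -> x 0 2 = y 0 2 -> x 0 3 = y 0 3 -> x = y.
Proof.
move=> e0 e1 e2 e3; apply/rowP => -[[|[|[|[|//]]]] i].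
- by rewrite (_ : Ordinal i = 0) //; apply/val_inj.
- by rewrite (_ : Ordinal i = 1) //; apply/val_inj.
- by rewrite (_ : Ordinal i = 2) //; apply/val_inj.
- by rewrite (_ : Ordinal i = 3) //; apply/val_inj.
Qed.

Definition span1 := (<[row4 0%R 1%R 0%R 0%R]> + <[row4 0%R 0%R 0%R 1%R]>)%VS.
Definition span2 := (<[row4 1%R 0%R 0%R 0%R]> + <[row4 0%R 0%R 1%R 0%R]>)%VS.
Definition span3 := (<[row4 1%R 0%R 0%R 1%R]> + <[row4 0%R 1%R 1%R 0%R]>)%VS.

Lemma mem_span1 x : (x 0 0 == 0) && (x 0 2 == 0) = (x \in span1).
Proof.
apply/andP/memv_line2P => [[/eqP x0 /eqP x2]|[a [b ->]]].
  by exists (x 0 1), (x 0 3); apply: row4P; rewrite !mxE /= ?x0 ?x2; ring.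
by rewrite !mxE /= !mulr0 addr0.
Qed.

Lemma mem_span2 x : (x 0 1 == 0) && (x 0 3 == 0) = (x \in span2).
Proof.
apply/andP/memv_line2P => [[/eqP x1 /eqP x3]|[a [b ->]]].
  by exists (x 0 0), (x 0 2); apply: row4P; rewrite !mxE /= ?x1 ?x3; ring.
by rewrite !mxE /= !mulr0 addr0.
Qed.

Lemma mem_span3 x : (x 0 0 == x 0 3) && (x 0 1 == x 0 2) = (x \in span3).
Proof.
apply/andP/memv_line2P => [[/eqP x3 /eqP x2]|[a [b ->]]].
  by exists (x 0 0), (x 0 1); apply: row4P; rewrite !mxE /= -?x3 -?x2; ring.
by rewrite !mxE /= !mulr0 !addr0 add0r.
Qed.

Lemma dim_span1 : \dim span1 = 2%N.
Proof.
apply: dimv_line2; first by apply/eqP => /rowP/(_ 1)/eqP; rewrite !mxE oner_eq0.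
apply/vlineP => -[k /rowP/(_ 3)/eqP]; by rewrite !mxE /= mulr0 oner_eq0.
Qed.

Lemma dim_span2 : \dim span2 = 2%N.
Proof.
apply: dimv_line2; first by apply/eqP => /rowP/(_ 0)/eqP; rewrite !mxE oner_eq0.
apply/vlineP => -[k /rowP/(_ 2)/eqP]; by rewrite !mxE /= mulr0 oner_eq0.
Qed.

Lemma dim_span3 : \dim span3 = 2%N.
Proof.
apply: dimv_line2; first by apply/eqP => /rowP/(_ 0)/eqP; rewrite !mxE oner_eq0.
apply/vlineP => -[k /rowP/(_ 1)/eqP]; by rewrite !mxE /= mulr0 oner_eq0.
Qed.

Definition on_quadric x := x 0 0 * x 0 1 == x 0 2 * x 0 3.

Lemma span1_quadric x : x \in span1 -> on_quadric x.
Proof.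
by rewrite -mem_span1 /on_quadric => /andP[/eqP-> /eqP->]; rewrite !mul0r.
Qed.

Lemma span2_quadric x : x \in span2 -> on_quadric x.
Proof.
by rewrite -mem_span2 /on_quadric => /andP[/eqP-> /eqP->]; rewrite !mulr0.
Qed.

Lemma span3_quadric x : x \in span3 -> on_quadric x.
Proof.
by rewrite -mem_span3 /on_quadric => /andP[/eqP-> /eqP->]; rewrite mulrC.
Qed.

Lemma span12_disjoint x : x \in span1 -> x \in span2 -> x = 0.
Proof.
rewrite -mem_span1 -mem_span2 => /andP[/eqP x0 /eqP x2] /andP[/eqP x1 /eqP x3].
by apply: row4P; rewrite mxE.
Qed.

Lemma span13_disjoint x : x \in span1 -> x \in span3 -> x = 0.
Proof.
rewrite -mem_span1 -mem_span3 => /andP[/eqP x0 /eqP x2] /andP[/eqP x3 /eqP x1].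
by apply: row4P; rewrite mxE -?x3 ?x1.
Qed.

Lemma span23_disjoint x : x \in span2 -> x \in span3 -> x = 0.
Proof.
rewrite -mem_span2 -mem_span3 => /andP[/eqP x1 /eqP x3] /andP[/eqP x0 /eqP x2].
by apply: row4P; rewrite mxE -?x2 ?x0.
Qed.

(** A line through x, y and z is a transversal of the three lines. Writing z = s x + t y, the
    equations of the third line become t y_0 = s x_3 and t y_2 = s x_1, and these force every k x +
    m y onto the quadric. *)
Lemma regulus_quadric x y z w :
    x \in span1 -> y \in span2 -> z \in span3 -> z != 0 ->
    z \in (<[x]> + <[y]>)%VS -> w \in (<[x]> + <[y]>)%VS ->
  on_quadric w.
Proof.
move=> x1 y2 z3 z0 /memv_line2P[s [t def_z]] /memv_line2P[k [m ->]].
(* If t = 0, z would lie on both the first and the third line. *)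
have t0 : t != 0.
  apply: contraNneq z0 => t0; apply/eqP/span13_disjoint => //.
  by rewrite def_z t0 scale0r addr0 memvZ.
move: z3 x1 y2; rewrite -mem_span3 -mem_span1 -mem_span2 def_z !mxE.
case/andP=> /eqP e03 /eqP e12 /andP[/eqP x0 /eqP x2] /andP[/eqP y1 /eqP y3].
move: e03 e12; rewrite /on_quadric !mxE x0 x2 y1 y3 => e03 e12.
have {}e03 : t * y 0 0 = s * x 0 3 by move: e03; rewrite !(mulr0, add0r, addr0).
have {}e12 : t * y 0 2 = s * x 0 1 by move: e12; rewrite !(mulr0, add0r, addr0).
(* After multiplication by t, both sides equal k m s x_1 x_3. *)
apply/eqP/(mulfI t0).
transitivity (k * m * (t * y 0 0) * x 0 1); first by ring.
transitivity (k * m * (t * y 0 2) * x 0 3); last by ring.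
by rewrite e03 e12; ring.
Qed.

(** Passes from points to vectors: the equation is homogeneous of degree 2, so one nonzero solution
    puts its whole point on the quadric. *)
Lemma disjoint_quadric (g : {vspace 'rV[F]_4}) x :
    [disjoint points_of g & hyperbolic_quadric F] ->
  x \in g -> on_quadric x -> x = 0.
Proof.
move=> gQ xg /eqP xQ; apply/eqP/negPn/negP => x0.
have /negP[] := disjointFr gQ (etrans (point_in x0 g) xg).
rewrite inE; apply/'forall_implyP => _ /vlineP[k ->]; rewrite !mxE.
by rewrite mulrACA xQ mulrACA.
Qed.

End FourLines.

(** * Size and blocking property of the union *)

Theorem theorem5 (q : nat) (F : finFieldType) (hq : #|F| = q)
    (g : {vspace 'rV[F]_4}) (g_line : \dim g = 2%N)
    (g_disj : [disjoint points_of g & hyperbolic_quadric F]) :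
  let B := line1 F :|: line2 F :|: line3 F :|: points_of g in
  #|B| = (4 * q + 4)%N /\ strong_blocking_set 3 B.
Proof.
rewrite /line1 (locus_points_of (@mem_span1 F)).
rewrite /line2 (locus_points_of (@mem_span2 F)).
rewrite /line3 (locus_points_of (@mem_span3 F)) /=.
set B := (_ :|: points_of g).
have gQ := disjoint_quadric g_disj.
split.
  have card_line U : \dim U = 2%N -> #|points_of U : {set pg_point F 3}| = q.+1.
    move=> dimU; have := card_points_of U; have := finNzRing_gt1 F.
    (* The factor q - 1 is positive and cancels from (q + 1)(q - 1) = q^2 - 1. *)
    rewrite dimU hq => q1 E; apply/eqP; rewrite -(eqn_pmul2r (_ : 0 < q.-1)%N).
      by rewrite E; nia.
    by lia.
  have card_disj (A C : {set pg_point F 3}) : [disjoint A & C] ->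
      #|A :|: C| = (#|A| + #|C|)%N.
    by move=> dAC; rewrite cardsU (disjoint_setI0 dAC) cards0 subn0.
  have disjointU (A C D : {set pg_point F 3}) :
      [disjoint A :|: C & D] = [disjoint A & D] && [disjoint C & D].
    by rewrite -!setI_eq0 setIUl setU_eq0.
  have disj (U V : {vspace 'rV[F]_4}) : (forall x, x \in U -> x \in V -> x = 0) ->
      [disjoint (points_of U : {set pg_point F 3}) & points_of V].
    move=> UV; apply/disjoint_points_of/eqP; rewrite -subv0; apply/subvP => x.
    by rewrite memv_cap memv0 => /andP[xU /(UV _ xU) ->].
  rewrite /B !card_disj ?card_line //; first by lia.
  - exact: dim_span3.
  - exact: dim_span2.
  - exact: dim_span1.
  - by apply: disj; apply: span12_disjoint.
  - by rewrite disjointU !disj //; [apply: span23_disjoint|apply: span13_disjoint].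
  - rewrite !disjointU !disj // => x xl xg; apply: gQ xg _.
    + exact: span3_quadric.
    + exact: span2_quadric.
    + exact: span1_quadric.
move=> U dimU.
(* The vector dimensions 3 and 2 add up to more than 4. *)
have meet V : \dim V = 2%N -> exists x, [/\ x \in U, x \in V & x != 0].
  by move=> dimV; apply: exists_capv; rewrite dimU dimV dim_matrix.
have [x [xU x1 x0]] := meet _ (dim_span1 F).
have [y [yU y2 y0]] := meet _ (dim_span2 F).
have [z [zU z3 z0]] := meet _ (dim_span3 F).
have [w [wU wg w0]] := meet _ g_line.
have yx : y \notin <[x]>%VS.
  apply: contraNN y0 => /vlineP[k def_y]; apply/eqP/span12_disjoint => //.
  by rewrite def_y memvZ.
have xB : point x0 \in B by rewrite !(in_setU, point_in) x1.
have yB : point y0 \in B by rewrite !(in_setU, point_in) y2 orbT.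
have zB : point z0 \in B by rewrite !(in_setU, point_in) z3 !orbT.
have wB : point w0 \in B by rewrite !(in_setU, point_in) wg !orbT.
(* When z is collinear with x and y, w takes its place. *)
have [zxy|zxy] := boolP (z \in (<[x]> + <[y]>)%VS); last first.
  exact: (@span_point3 _ _ _ _ _ _ _ x0 y0 z0).
apply: (@span_point3 _ _ _ _ _ _ _ x0 y0 w0) => //.
(* Were w on that transversal, it would be on the quadric as well as on [g], hence zero. *)
by apply: contraNN (w0) => /(regulus_quadric x1 y2 z3 z0 zxy)/(gQ _ wg)/eqP.
Qed.
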